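(* Let $R$ be an associative unital ring, let $u,v\in S_n$ and $i\in[1,n-1]$ be such that $\ell(us_i)=\ell(u)+1$ and $\ell(vs_i)=\ell(v)+1$. Then the following identities hold when evaluated at any $x\in \mathrm{Mat}_n(R)$ for which all the positive quasiminors and inverses involved are defined: $$\Delta^i_{us_i,vs_i}=\Delta^i_{us_i,v}(\Delta^i_{u,v})^{-1}\Delta^i_{u,vs_i}+\Delta^{i+1}_{u,v},$$ $$(\Delta^i_{us_i,v})^{-1}\Delta^{i+1}_{u,v}=(\Delta^i_{u,v})^{-1}\Delta^{i+1}_{us_i,v},\qquad \Delta^{i+1}_{u,v}(\Delta^i_{u,vs_i})^{-1}=\Delta^{i+1}_{u,vs_i}(\Delta^i_{u,v})^{-1},$$ $$\Delta^{i+1}_{u,v}(\Delta^{i+1}_{us_i,v})^{-1}=\Delta^i_{us_i,v}(\Delta^i_{u,v})^{-1},\qquad (\Delta^{i+1}_{u,vs_i})^{-1}\Delta^{i+1}_{u,v}=(\Delta^i_{u,v})^{-1}\Delta^i_{u,vs_i}.$$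
   Context: $[a,b]=\{a,\dots,b\}$; $s_i=(i,i+1)\in S_n$ is the simple transposition and $\ell(w)$ is the number of inversions of $w\in S_n$. Quasideterminants: for a square matrix $A=(a_{ij})_{i\in I,j\in J}$ over $R$, $|A|_{ij}=a_{ij}$ if $|I|=1$; otherwise, if $A^{ij}$ ($A$ with row $i$ and column $j$ deleted) is invertible, $|A|_{ij}=a_{ij}-r_i(A^{ij})^{-1}c_j$, where $r_i$ is row $i$ of $A$ without $a_{ij}$ and $c_j$ is column $j$ of $A$ without $a_{ij}$. Positive quasiminors: for $I,J\subset[1,n]$ with $|I|=|J|$, $i\in I$, $j\in J$, $\Delta^{i,j}_{I,J}(x)=(-1)^{d_i(I)+d_j(J)}|x_{I,J}|_{i,j}$, where $x_{I,J}$ is the submatrix with rows $I$ and columns $J$, and $d_i(I)$ (resp. $d_j(J)$) is the number of elements of $I$ greater than $i$ (resp. of $J$ greater than $j$). For $u,v\in S_n$ and $k\in[1,n]$, $\Delta^k_{u,v}:=\Delta^{u(k),v(k)}_{u[1,k],v[1,k]}$. *)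

(* Defs.v *)
From HB Require Import structures.
From mathcomp Require Import all_boot all_order all_fingroup all_algebra.
From mathcomp Require Import boolp classical_sets.

Set Implicit Arguments.
Unset Strict Implicit.
Unset Printing Implicit Defensive.

Import GRing.Theory.
Local Open Scope ring_scope.

(* The ring is an arbitrary, possibly noncommutative, [pzRingType], for which
   neither a unit predicate nor a matrix inverse is available.  The partial
   operations (inverse, quasideterminant, quasiminor) are total functions with
   an irrelevant default value, each paired with a definedness predicate. *)

Section RingInverse.
Variable R : pzRingType.

Definition is_ringinv (a b : R) : Prop := a * b = 1 /\ b * a = 1.

Definition invertible (a : R) : Prop := exists b, is_ringinv a b.

Definition ringinv (a : R) : R := xget 0 [set b | is_ringinv a b]%classic.

(* The inverse of a matrix with rows I and columns J has rows J and columns I;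
   allowing p and q to be distinct terms avoids casts along #|I| = #|J|. *)
Definition is_mxinv p q (A : 'M[R]_(p, q)) (B : 'M[R]_(q, p)) : Prop :=
  A *m B = 1%:M /\ B *m A = 1%:M.

Definition mx_invertible p q (A : 'M[R]_(p, q)) : Prop :=
  exists B, is_mxinv A B.

Definition mxinv p q (A : 'M[R]_(p, q)) : 'M[R]_(q, p) :=
  xget 0 [set B | is_mxinv A B]%classic.

End RingInverse.

Section Quasideterminant.
Variables (R : pzRingType) (m n : nat).
Implicit Types (x : 'M[R]_(m, n)) (I : {set 'I_m}) (J : {set 'I_n}).

Definition submx_of x I J : 'M[R]_(#|I|, #|J|) :=
  \matrix_(k, l) x (enum_val k) (enum_val l).

(* [qdet x I J i j] is |A|_ij for A = (x_kl)_(k in I, l in J); it is meaningful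
   when #|I| = #|J|, i \in I and j \in J. *)
Definition qdet_defined x I J (i : 'I_m) (j : 'I_n) : Prop :=
  #|I| = 1%N \/ mx_invertible (submx_of x (I :\ i) (J :\ j)).

Definition qdet x I J (i : 'I_m) (j : 'I_n) : R :=
  if #|I| == 1%N then x i j else
  let r := \row_(l < #|J :\ j|) x i (enum_val l) in
  let c := \col_(k < #|I :\ i|) x (enum_val k) j in
  x i j - (r *m mxinv (submx_of x (I :\ i) (J :\ j)) *m c) 0 0.

End Quasideterminant.

Section PositiveQuasiminor.
Variables (R : pzRingType) (n : nat).
Implicit Types (x : 'M[R]_n) (I J : {set 'I_n}) (u v w : 'S_n).

Definition num_greater I (i : 'I_n) : nat := #|[set k in I | (i < k)%N]|.

Definition posqminor x I J (i j : 'I_n) : R :=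
  (-1) ^+ (num_greater I i + num_greater J j) * qdet x I J i j.

Definition perm_length w : nat :=
  #|[set p : 'I_n * 'I_n | (p.1 < p.2)%N && (w p.2 < w p.1)%N]|.

(* Indices are 0-based: k : 'I_n stands for k + 1 in [1, n], so that
   [init_seg k] is the interval [1, k + 1]. *)
Definition init_seg (k : 'I_n) : {set 'I_n} := [set l : 'I_n | (l <= k)%N].

Definition Delta_defined (k : 'I_n) u v x : Prop :=
  qdet_defined x (u @: init_seg k) (v @: init_seg k) (u k) (v k).

Definition Delta (k : 'I_n) u v x : R :=
  posqminor x (u @: init_seg k) (v @: init_seg k) (u k) (v k).

(* Permutations are multiplied as functions, (u s)(k) = u (s k), whereas in
   MathComp (s * t) k = t (s k): hence the reversed order. [swap_after u i i1]
   is u s_i when i1 is the successor of i. *)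
Definition swap_after u (i i1 : 'I_n) : 'S_n := (tperm i i1 * u)%g.

End PositiveQuasiminor.

(* Main.v *)
(** Let [K], [L] be the images under [u], [v] of the first [i - 1] indices,
    and [a = u i], [c = u (i + 1)], [b = v i], [d = v (i + 1)].  The
    quasideterminants of order [i] are the entries [p_ab], [p_ad], [p_cb],
    [p_cd] of the Schur complement of [x_{K,L}], and those of order [i + 1] are
    iterated Schur complements, such as [p_cd - p_cb p_ab^-1 p_ad].  The length
    hypotheses mean [a < c] and [b < d], so that exchanging [a] and [c], or [b]
    and [d], in a quasiminor of order [i + 1] costs one extra sign.  With the
    signs absorbed in the [p]'s, all the identities are formal consequences of
    these formulas.  A Schur complement is handled here through the coefficients
    [w] expressing a row, restricted to the columns [L], as a left linear
    combination of the rows in [K]. *)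
Require Import Defs.
From HB Require Import structures.
From mathcomp Require Import all_boot all_order all_fingroup all_algebra.
From mathcomp Require classical_sets.
From mathcomp Require Import zify.

Set Implicit Arguments.
Unset Strict Implicit.
Unset Printing Implicit Defensive.

Import GRing.Theory.
Local Open Scope ring_scope.

(** * Two-sided inverses and signs in a noncommutative ring *)

Section RingInverse.
Variable R : pzRingType.

Lemma ringinvP (a : R) : invertible a -> is_ringinv a (ringinv a).
Proof. by case=> b ab; rewrite /ringinv; case: classical_sets.xgetP => // /(_ b). Qed.

Lemma mxinvP p q (A : 'M[R]_(p, q)) : mx_invertible A -> is_mxinv A (mxinv A).
Proof. by case=> B AB; rewrite /mxinv; case: classical_sets.xgetP => // /(_ B). Qed.

Lemma mulr_sign_sign (k l : nat) (a b : R) :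
  (-1) ^+ k * a * ((-1) ^+ l * b) = (-1) ^+ (k + l) * (a * b).
Proof. by rewrite exprD -!mulrA; congr (_ * _); rewrite !mulrA commr_sign. Qed.

Lemma is_ringinv_sign (k : nat) (a b : R) :
  is_ringinv a b -> is_ringinv ((-1) ^+ k * a) ((-1) ^+ k * b).
Proof.
by case=> ab ba; split; rewrite mulr_sign_sign exprD -expr2 sqrr_sign mul1r.
Qed.

Lemma is_ringinv_uniq (a b c : R) : is_ringinv a b -> is_ringinv a c -> b = c.
Proof. by case=> _ ba [ac _]; rewrite -[b]mulr1 -ac mulrA ba mul1r. Qed.

End RingInverse.

(* [(a, b; c, d)] is the 2 x 2 Schur complement [(p_ab, p_ad; p_cb, p_cd)];
   [y] is the inverse of [a], and [z] that of [c] (rows) or [b] (columns). *)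
Section NoncommutativeSchur.
Variables (R : pzRingType) (a b c d y z : R).

Lemma schur_row_quotient : y * a = 1 -> z * c = 1 ->
  z * (d - c * y * b) = y * - (b - a * z * d).
Proof. by move=> ya zc; rewrite opprB !mulrBr !mulrA ya zc !mul1r. Qed.

Lemma schur_col_quotient : a * y = 1 -> b * z = 1 ->
  (d - c * y * b) * z = - (c - d * z * a) * y.
Proof. by move=> ay bz; rewrite opprB !mulrBl -!mulrA ay bz !mulr1. Qed.

Lemma schur_row_swap : y * a = 1 -> c * z = 1 ->
  d - c * y * b = c * y * - (b - a * z * d).
Proof.
move=> ya cz; rewrite opprB mulrBr !mulrA -(mulrA c y a) ya mulr1 cz.
by rewrite mul1r.
Qed.

Lemma schur_col_swap : a * y = 1 -> z * b = 1 ->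
  d - c * y * b = - (c - d * z * a) * (y * b).
Proof.
move=> ay zb; rewrite opprB mulrBl -!mulrA (mulrA a y b) ay mul1r zb.
by rewrite mulr1.
Qed.

End NoncommutativeSchur.

(** * Quasideterminants through linear combinations of rows *)

Section RowCoefficients.
Variables (R : pzRingType) (m n : nat) (x : 'M[R]_(m, n)).
Implicit Types (I K : {set 'I_m}) (J L : {set 'I_n}) (w : 'I_m -> R).

(** The coefficients are a function on all of ['I_m], constrained only on [K], so that [K] can grow
    to [a |: K] without reindexing a vector of length [#|K|]. *)
Definition row_coeffs K L w (y : 'I_n -> R) : Prop :=
  {in L, forall l, \sum_(k in K) w k * x k l = y l}.

Lemma row_coeffs_mulmx K L w y : row_coeffs K L w y <->
  \row_(k < #|K|) w (enum_val k) *m submx_of x K L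
    = \row_(l < #|L|) y (enum_val l).
Proof.
split=> [wy | /rowP wy l lL].
  apply/rowP => l; rewrite !mxE -(wy _ (enum_valP l)) [RHS]big_enum_val.
  by apply: eq_bigr => k _; rewrite !mxE.
have := wy (enum_rank_in lL l); rewrite !mxE enum_rankK_in // => <-.
rewrite [LHS]big_enum_val; apply: eq_bigr => k _.
by rewrite !mxE enum_rankK_in.
Qed.

Lemma row_coeffs_exists K L y :
  mx_invertible (submx_of x K L) -> exists w, row_coeffs K L w y.
Proof.
case=> B [_ BA]; pose r := \row_(l < #|L|) y (enum_val l) *m B.
(* This extends the row vector [r] by zero outside [K]; for [k] in [K] the sum has exactly one
   term. *)
exists (fun k => \sum_(q | enum_val q == k) r 0 q); apply/row_coeffs_mulmx.
rewrite -[RHS]mulmx1 -BA mulmxA -/r; congr (_ *m _); apply/rowP => q.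
by rewrite mxE (big_pred1 q) // => q'; rewrite (inj_eq enum_val_inj).
Qed.

Lemma row_coeffs_inj K L w w' y : mx_invertible (submx_of x K L) ->
  row_coeffs K L w y -> row_coeffs K L w' y -> {in K, w =1 w'}.
Proof.
case=> B [AB _] /row_coeffs_mulmx wy /row_coeffs_mulmx w'y k kK.
have /rowP/(_ (enum_rank_in kK k)) :
    \row_(k < #|K|) w (enum_val k) = \row_(k < #|K|) w' (enum_val k).
  by rewrite -[LHS]mulmx1 -[RHS]mulmx1 -AB !mulmxA wy w'y.
by rewrite !mxE enum_rankK_in.
Qed.

(** When row [i] without column [j] is [w] times the deleted block, right multiplication by the
    inverse block gives back [w], so the correction term is [w] times column [j]. In order 1 that
    term is an empty sum. *)
Lemma qdet_row_coeffs I J i j w : i \in I -> qdet_defined x I J i j ->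
  row_coeffs (I :\ i) (J :\ j) w (x i) ->
  qdet x I J i j = x i j - \sum_(k in I :\ i) w k * x k j.
Proof.
move=> iI; rewrite /qdet; case: ifPn => [I1 _ _ | I1 [/eqP | A_inv]].
- rewrite (_ : I :\ i = set0) ?big_set0 ?subr0 //.
  by apply/eqP; rewrite -cards_eq0 -eqSS -(eqP I1) (cardsD1 i I) iI.
- by rewrite (negPf I1).
have [AB _] := mxinvP A_inv.
move=> /row_coeffs_mulmx <-; rewrite -(mulmxA _ _ (mxinv _)) AB mulmx1 mxE.
by rewrite [in RHS]big_enum_val; congr (_ - _); apply: eq_bigr => k _; rewrite !mxE.
Qed.

(** In order 1 the deleted block is empty and the zero matrix inverts it, so both clauses of
    definedness give one uniform condition. *)
Lemma qdet_defined_invertible I J i j : i \in I -> j \in J -> #|I| = #|J| ->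
  qdet_defined x I J i j -> mx_invertible (submx_of x (I :\ i) (J :\ j)).
Proof.
move=> iI jJ IJ [I1 | //].
have I0 : #|I :\ i| = 0%N by move: I1; rewrite (cardsD1 i) iI => -[].
have J0 : #|J :\ j| = 0%N by move: I1; rewrite IJ (cardsD1 j) jJ => -[].
exists 0; split; apply/matrixP => p q; exfalso.
  by move: p {q}; rewrite I0 => -[].
by move: p {q}; rewrite J0 => -[].
Qed.

Lemma qdet_setU1 K L a b w : a \notin K -> b \notin L ->
  mx_invertible (submx_of x K L) -> row_coeffs K L w (x a) ->
  qdet x (a |: K) (b |: L) a b = x a b - \sum_(k in K) w k * x k b.
Proof.
move=> aK bL A_inv wa; rewrite (qdet_row_coeffs (w := w)) ?setU11 ?setU1K //.
by right; rewrite !setU1K.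
Qed.

End RowCoefficients.

(** * Invertibility and iteration of Schur complements *)

Section SchurComplement.
Variables (R : pzRingType) (m n : nat) (x : 'M[R]_(m, n)).
Variables (K : {set 'I_m}) (L : {set 'I_n}).
Hypothesis A_inv : mx_invertible (submx_of x K L).

Let p a b := qdet x (a |: K) (b |: L) a b.

(** The inverse of [p a b] is the entry in row [b] and column [a] of the inverse of the larger
    block. In the proof [z] is that row [b], and the entry is [z a]. *)
Lemma qdet_invertible a b : a \notin K -> b \notin L ->
  mx_invertible (submx_of x (a |: K) (b |: L)) -> invertible (p a b).
Proof.
move=> aK bL X_inv; have [w wa] := row_coeffs_exists (x a) A_inv.
have [z zb] := row_coeffs_exists (fun l => (l == b)%:R) X_inv.
have pE : p a b = x a b - \sum_(k in K) w k * x k b by apply: qdet_setU1.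
have bLF l : l \in L -> (l == b) = false.
  by move=> lL; apply: contraNF bL => /eqP <-.
have aKF k : k \in K -> (k == a) = false.
  by move=> kK; apply: contraNF aK => /eqP <-.
(* On the columns in [L], the rows in [K] weighted by [z] must cancel [z a] times row [a];
   uniqueness of coefficients then determines [z] on [K]. *)
have zw : {in K, z =1 (fun k => - (z a * w k))}.
  apply: (row_coeffs_inj (y := fun l => - (z a * x a l)) A_inv) => l lL.
    have := zb l (setU1r _ lL); rewrite big_setU1 //= bLF // => /eqP.
    by rewrite addrC addr_eq0 => /eqP.
  rewrite -(wa l lL) mulr_sumr -sumrN.
  by apply: eq_bigr => k _; rewrite mulNr mulrA.
exists (z a); split.
  (* [e] subtracts from row [a] its combination of rows in [K]. The result is zero on [L] and
     [p a b] at column [b], as for the coefficients [p a b * z k]; uniqueness over the larger block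
     identifies the two. *)
  pose e k := if k == a then 1 else - w k.
  suff /(_ a (setU11 _ _)) : {in a |: K, (fun k => p a b * z k) =1 e}.
    by rewrite /e eqxx.
  apply: (row_coeffs_inj (y := fun l => p a b * (l == b)%:R) X_inv) => l lL.
    by rewrite -(zb l lL) mulr_sumr; apply: eq_bigr => k _; rewrite mulrA.
  rewrite big_setU1 //= /e eqxx mul1r.
  rewrite (eq_bigr (fun k => - (w k * x k l))); last first.
    by move=> k kK; rewrite aKF // mulNr.
  rewrite sumrN; case/setU1P: lL => [-> | lL]; first by rewrite eqxx mulr1 pE.
  by rewrite wa // subrr bLF // mulr0.
(* With [z] known on [K], the relation in column [b] reads [z a * p a b = 1]. *)
have := zb b (setU11 _ _); rewrite big_setU1 //= eqxx => zb1.
rewrite -[RHS]zb1 pE mulrBr mulr_sumr -sumrN; congr (_ + _).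
by apply: eq_bigr => k kK; rewrite (zw k kK) mulNr mulrA.
Qed.

(** One elimination step: row [a], reduced by the rows in [K], serves as pivot row for column
    [b]. *)
Lemma qdet_schur a b c d y :
  a \notin K -> c \notin K -> b \notin L -> d \notin L -> a != c -> b != d ->
  mx_invertible (submx_of x (a |: K) (b |: L)) -> is_ringinv (p a b) y ->
  qdet x (c |: (a |: K)) (d |: (b |: L)) c d = p c d - p c b * y * p a d.
Proof.
move=> aK cK bL dL ac bd X_inv [_ yp].
have [w wa] := row_coeffs_exists (x a) A_inv.
have [v vc] := row_coeffs_exists (x c) A_inv.
(* [t] is chosen so that [t * p a b = p c b]. Adding [t] times the reduced row [a], which vanishes
   on [L], to the combination given by [v] keeps the columns in [L] and corrects column [b]. *)
pose t := p c b * y.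
pose z k := if k == a then t else v k - t * w k.
have aKF k : k \in K -> (k == a) = false.
  by move=> kK; apply: contraNF aK => /eqP <-.
have zE l : \sum_(k in a |: K) z k * x k l =
    t * (x a l - \sum_(k in K) w k * x k l) + \sum_(k in K) v k * x k l.
  rewrite big_setU1 //= {1}/z eqxx mulrBr -addrA; congr (_ + _).
  rewrite mulr_sumr addrC -sumrB; apply: eq_bigr => k kK.
  by rewrite /z aKF // mulrBl mulrA.
have pE e f s : e \notin K -> f \notin L -> row_coeffs x K L s (x e) ->
    p e f = x e f - \sum_(k in K) s k * x k f by move=> *; apply: qdet_setU1.
have caK : c \notin a |: K by rewrite in_setU1 negb_or eq_sym ac.
have dbL : d \notin b |: L by rewrite in_setU1 negb_or eq_sym bd.
rewrite (qdet_setU1 (w := z)) //.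
  by rewrite zE (pE c d v) // (pE a d w) // -/t opprD addrA addrAC.
move=> l; rewrite zE => /setU1P[-> | lL].
  by rewrite -(pE a b w) // /t -mulrA yp mulr1 (pE c b v) // subrK.
by rewrite wa // subrr mulr0 add0r vc.
Qed.

End SchurComplement.

(** * The Schur complement formula with signs *)

Section PositiveQuasiminor.
Variables (R : pzRingType) (n : nat) (x : 'M[R]_n).
Implicit Types K L : {set 'I_n}.

Lemma num_greater_setU1 K (c a : 'I_n) : c \notin K ->
  num_greater (c |: K) a = ((a < c) + num_greater K a)%N.
Proof.
move=> cK; rewrite /num_greater.
have -> : [set k in c |: K | (a < k)%N] =
    (if (a < c)%N then [set c] else set0) :|: [set k in K | (a < k)%N].
  apply/setP => k; rewrite !inE; case: eqVneq => [-> | kc] /=.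
    by case: ifP => ac; rewrite !inE ?eqxx //= (negPf cK).
  by case: ifP => ac; rewrite !inE ?(negPf kc).
case: ifP => _; last by rewrite set0U.
by rewrite cardsU1 !inE (negPf cK).
Qed.

Lemma posqminor_invertible K L a b : mx_invertible (submx_of x K L) ->
  a \notin K -> b \notin L -> mx_invertible (submx_of x (a |: K) (b |: L)) ->
  invertible (posqminor x (a |: K) (b |: L) a b).
Proof.
move=> A_inv aK bL /(qdet_invertible A_inv aK bL)[y py].
by eexists; apply: is_ringinv_sign py.
Qed.

(** Enlarging [K] by [a] and [L] by [b] changes the sign at [c] and [d] exactly by the comparisons
    [c < a] and [d < b]. *)
Lemma posqminor_schur K L a b c d : mx_invertible (submx_of x K L) ->
  a \notin K -> c \notin K -> b \notin L -> d \notin L -> a != c -> b != d ->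
  mx_invertible (submx_of x (a |: K) (b |: L)) ->
  posqminor x (c |: (a |: K)) (d |: (b |: L)) c d =
    (-1) ^+ ((c < a) + (d < b))%N *
    (posqminor x (c |: K) (d |: L) c d
     - posqminor x (c |: K) (b |: L) c b
       * ringinv (posqminor x (a |: K) (b |: L) a b)
       * posqminor x (a |: K) (d |: L) a d).
Proof.
move=> A_inv aK cK bL dL ac bd X_inv.
have [y py] := qdet_invertible A_inv aK bL X_inv.
have Py : is_ringinv (posqminor x (a |: K) (b |: L) a b) _ :=
  is_ringinv_sign _ py.
have -> := is_ringinv_uniq (ringinvP (ex_intro _ _ Py)) Py.
rewrite {1}/posqminor (qdet_schur A_inv _ _ _ _ ac bd X_inv py) //.
have caK : c \notin a |: K by rewrite in_setU1 negb_or eq_sym ac.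
have dbL : d \notin b |: L by rewrite in_setU1 negb_or eq_sym bd.
rewrite /posqminor !num_greater_setU1 //.
rewrite !ltnn !add0n addnACA exprD -mulrA; congr (_ * _).
move: (num_greater K a) (num_greater K c) (num_greater L b) (num_greater L d).
move=> ga gc gb gd.
rewrite mulrBr; congr (_ - _).
(* In the triple product the signs of [a] and [b] occur twice each and cancel modulo 2, leaving
   those of [c] and [d]. *)
rewrite !mulr_sign_sign -signr_odd -[in RHS]signr_odd; congr ((-1) ^+ _ * _).
by rewrite !oddD; case: (odd ga) (odd gb) (odd gc) (odd gd) => [] [] [] [].
Qed.

End PositiveQuasiminor.

(** * Lengths, and images of initial segments *)

Section Permutations.
Variable n : nat.
Implicit Types u : 'S_n.

(** If [u i1 <= u i], applying the transposition to both positions injects the inversions of the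
    swapped permutation into those of [u]: the only pair of positions whose order it reverses is
    [(i, i1)], which is then not an inversion of the swapped permutation. *)
Lemma perm_length_swap_lt u (i i1 : 'I_n) : i1 = i.+1 :> nat ->
  perm_length (swap_after u i i1) = (perm_length u + 1)%N -> (u i < u i1)%N.
Proof.
move=> hi hu; rewrite ltnNge; apply/negP => u_le.
suff : (perm_length (swap_after u i i1) <= perm_length u)%N by rewrite hu; lia.
pose f (q : 'I_n * 'I_n) := (tperm i i1 q.1, tperm i i1 q.2).
have f_inj : injective f by move=> [a b] [c d] [/perm_inj -> /perm_inj ->].
rewrite /perm_length -(card_imset _ f_inj); apply/subset_leq_card/subsetP => q.
case/imsetP => -[a b]; rewrite inE /swap_after !permM /= => /andP[ab ub] ->.
rewrite inE /= ub andbT.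
have val_neq (j k : 'I_n) : j <> k -> nat_of_ord j <> k.
  by move=> jk /val_inj.
move: ub ab; case: tpermP => [-> | -> | /val_neq ai /val_neq ai1];
  case: tpermP => [-> | -> | /val_neq bi /val_neq bi1]; lia.
Qed.

(** These positions give [K] and [L]. The set is empty when [i] is 0, so it is not always an
    [init_seg]. *)
Definition below (i : 'I_n) : {set 'I_n} := [set l : 'I_n | (l < i)%N].

Lemma imset_init_seg u i : u @: init_seg i = u i |: u @: below i.
Proof.
have -> : init_seg i = i |: below i.
  by apply/setP => l; rewrite !inE -val_eqE leq_eqVlt.
by rewrite imsetU1.
Qed.

Lemma imset_below_succ u (i i1 : 'I_n) : i1 = i.+1 :> nat ->
  u @: below i1 = u i |: u @: below i.
Proof.
move=> hi; rewrite -imset_init_seg; suff -> : below i1 = init_seg i by [].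
by apply/setP => l; rewrite !inE hi.
Qed.

Lemma notin_imset_below u (i j : 'I_n) : (i <= j)%N -> u j \notin u @: below i.
Proof. by move=> ij; rewrite mem_imset ?inE -?leqNgt //; apply: perm_inj. Qed.

Lemma imset_swap_below u (i i1 : 'I_n) : i1 = i.+1 :> nat ->
  swap_after u i i1 @: below i = u @: below i.
Proof.
move=> hi; apply: eq_in_imset => l; rewrite inE => li.
by rewrite /swap_after permM tpermD // -val_eqE /= neq_ltn ?hi; lia.
Qed.

Lemma swap_after_l u (i i1 : 'I_n) : swap_after u i i1 i = u i1.
Proof. by rewrite /swap_after permM tpermL. Qed.

Lemma swap_after_r u (i i1 : 'I_n) : swap_after u i i1 i1 = u i.
Proof. by rewrite /swap_after permM tpermR. Qed.

(** Deleting [u k] and [v k] leaves the images of the earlier positions. At [k = i] this is the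
    block on [K] and [L]; at the successor of [i] it is the block on [a |: K] and [b |: L]. *)
Lemma Delta_defined_invertible (R : pzRingType) (x : 'M[R]_n) u v k :
  Delta_defined k u v x ->
  mx_invertible (submx_of x (u @: below k) (v @: below k)).
Proof.
rewrite /Delta_defined !imset_init_seg => /qdet_defined_invertible.
rewrite !setU1K ?notin_imset_below // !setU11; apply=> //.
by rewrite !cardsU1 !notin_imset_below // !card_imset //; apply: perm_inj.
Qed.

End Permutations.

(** * The Schur complement formula for [Delta] *)

Section DeltaSchur.
Variables (R : pzRingType) (n : nat) (x : 'M[R]_n) (i i1 : 'I_n).
Hypothesis hi : i1 = i.+1 :> nat.
Implicit Types u v : 'S_n.

(** Definedness one order higher makes the block on [a |: K] and [b |: L] invertible, which forces
    its Schur complement to be invertible. *)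
Lemma Delta_invertible u v :
  mx_invertible (submx_of x (u @: below i) (v @: below i)) ->
  Delta_defined i1 u v x -> invertible (Delta i u v x).
Proof.
move=> A_inv /Delta_defined_invertible.
rewrite !(imset_below_succ _ hi) /Delta !imset_init_seg.
by apply: posqminor_invertible; rewrite ?notin_imset_below.
Qed.

(** The sign stays explicit so that the formula also applies with [us] for [u] or [vs] for [v],
    where one comparison is reversed. *)
Lemma Delta_schur u v :
  let us := swap_after u i i1 in
  let vs := swap_after v i i1 in
  mx_invertible (submx_of x (u @: below i) (v @: below i)) ->
  Delta_defined i1 u v x ->
  Delta i1 u v x = (-1) ^+ ((u i1 < u i) + (v i1 < v i))%N *
    (Delta i us vs x
     - Delta i us v x * ringinv (Delta i u v x) * Delta i u vs x).
Proof.
move=> us vs A_inv /Delta_defined_invertible.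
rewrite !(imset_below_succ _ hi) => X_inv.
rewrite /Delta !imset_init_seg !(imset_below_succ _ hi) !(imset_swap_below _ hi).
rewrite !swap_after_l posqminor_schur // ?notin_imset_below ?hi //.
all: by rewrite (inj_eq perm_inj) -val_eqE /= hi; lia.
Qed.

End DeltaSchur.

(** * The five identities *)

Theorem proposition1p15 (R : pzRingType) (n : nat) (u v : 'S_n)
    (i i1 : 'I_n) (hi : i1 = i.+1 :> nat)
    (hu : perm_length (swap_after u i i1) = (perm_length u + 1)%N)
    (hv : perm_length (swap_after v i i1) = (perm_length v + 1)%N)
    (x : 'M[R]_n) :
  let us := swap_after u i i1 in
  let vs := swap_after v i i1 in
  (Delta_defined i us vs x -> Delta_defined i us v x ->
   Delta_defined i u v x -> invertible (Delta i u v x) ->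
   Delta_defined i u vs x -> Delta_defined i1 u v x ->
   Delta i us vs x =
     Delta i us v x * ringinv (Delta i u v x) * Delta i u vs x
     + Delta i1 u v x)
  /\
  (Delta_defined i us v x -> invertible (Delta i us v x) ->
   Delta_defined i1 u v x ->
   Delta_defined i u v x -> invertible (Delta i u v x) ->
   Delta_defined i1 us v x ->
   ringinv (Delta i us v x) * Delta i1 u v x =
     ringinv (Delta i u v x) * Delta i1 us v x)
  /\
  (Delta_defined i1 u v x ->
   Delta_defined i u vs x -> invertible (Delta i u vs x) ->
   Delta_defined i1 u vs x ->
   Delta_defined i u v x -> invertible (Delta i u v x) ->
   Delta i1 u v x * ringinv (Delta i u vs x) =
     Delta i1 u vs x * ringinv (Delta i u v x))
  /\
  (Delta_defined i1 u v x ->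
   Delta_defined i1 us v x -> invertible (Delta i1 us v x) ->
   Delta_defined i us v x ->
   Delta_defined i u v x -> invertible (Delta i u v x) ->
   Delta i1 u v x * ringinv (Delta i1 us v x) =
     Delta i us v x * ringinv (Delta i u v x))
  /\
  (Delta_defined i1 u vs x -> invertible (Delta i1 u vs x) ->
   Delta_defined i1 u v x ->
   Delta_defined i u v x -> invertible (Delta i u v x) ->
   Delta_defined i u vs x ->
   ringinv (Delta i1 u vs x) * Delta i1 u v x =
     ringinv (Delta i u v x) * Delta i u vs x).
Proof.
move=> us vs.
have uus : swap_after us i i1 = u by rewrite /us /swap_after mulgA tperm2 mul1g.
have vvs : swap_after vs i i1 = v by rewrite /vs /swap_after mulgA tperm2 mul1g.
have lu := perm_length_swap_lt hi hu; have lv := perm_length_swap_lt hi hv.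
have luF : (u i1 < u i)%N = false by lia.
have lvF : (v i1 < v i)%N = false by lia.
have DA := @Delta_defined_invertible n R x u v i.
pose A_inv := mx_invertible (submx_of x (u @: below i) (v @: below i)).
have D_uv : A_inv -> Delta_defined i1 u v x -> Delta i1 u v x =
    Delta i us vs x - Delta i us v x * ringinv (Delta i u v x) * Delta i u vs x.
  by move=> A dX; rewrite (Delta_schur hi) // luF lvF mul1r.
(* The pivot row is now [u i1], which exceeds [u i]: this comparison contributes the sign -1. *)
have D_usv : A_inv -> Delta_defined i1 us v x -> Delta i1 us v x =
    - (Delta i u vs x
       - Delta i u v x * ringinv (Delta i us v x) * Delta i us vs x).
  move=> A dX; rewrite (Delta_schur hi) ?(imset_swap_below _ hi) //.
  by rewrite !swap_after_l !swap_after_r uus lu lvF mulN1r.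
have D_uvs : A_inv -> Delta_defined i1 u vs x -> Delta i1 u vs x =
    - (Delta i us v x
       - Delta i us vs x * ringinv (Delta i u vs x) * Delta i u v x).
  move=> A dX; rewrite (Delta_schur hi) ?(imset_swap_below _ hi) //.
  by rewrite !swap_after_l !swap_after_r vvs lv luF mulN1r.
(* The last two identities use these inverses of order [i], which come from definedness one order
   higher. *)
have I_usv : A_inv -> Delta_defined i1 us v x -> invertible (Delta i us v x).
  by move=> A; apply: (Delta_invertible hi); rewrite (imset_swap_below _ hi).
have I_uvs : A_inv -> Delta_defined i1 u vs x -> invertible (Delta i u vs x).
  by move=> A; apply: (Delta_invertible hi); rewrite (imset_swap_below _ hi).
split; [|split; [|split; [|split]]].
- by move=> _ _ /DA A _ _ dX; rewrite (D_uv A dX) addrC subrK.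
- move=> _ /ringinvP[_ ic] dX /DA A /ringinvP[_ ia] dY.
  by rewrite (D_uv A dX) (D_usv A dY); apply: schur_row_quotient.
- move=> dX _ /ringinvP[ib _] dY /DA A /ringinvP[ia _].
  by rewrite (D_uv A dX) (D_uvs A dY); apply: schur_col_quotient.
- move=> dX dY /ringinvP[iq _] _ /DA A /ringinvP[_ ia].
  have [ic _] := ringinvP (I_usv A dY).
  (* Factoring out [Delta i1 us v x] on the right lets its inverse cancel. *)
  have -> : Delta i1 u v x
      = Delta i us v x * ringinv (Delta i u v x) * Delta i1 us v x.
    by rewrite (D_uv A dX) (D_usv A dY); apply: schur_row_swap.
  by rewrite -mulrA iq mulr1.
- move=> dY /ringinvP[_ iq] dX /DA A /ringinvP[ia _] _.
  have [_ ib] := ringinvP (I_uvs A dY).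
  (* Here the factor [Delta i1 u vs x] appears on the left instead. *)
  have -> : Delta i1 u v x
      = Delta i1 u vs x * (ringinv (Delta i u v x) * Delta i u vs x).
    by rewrite (D_uv A dX) (D_uvs A dY); apply: schur_col_swap.
  by rewrite mulrA iq mul1r.
Qed.
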